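(* Let $d$ be a rotationally invariant homogeneous distance on $\mathbb{H}$ with radial profile $\varphi: [-r_d,r_d] \rightarrow [0,+\infty)$. Assume that $|\varphi'(s)/s|$ is essentially bounded in a neighbourhood of $0$ (which holds in particular if $\varphi \in C^1((-r_d,r_d))$ and $\varphi'$ is differentiable at $0$). Then BCP holds in $(\mathbb{H},d)$ if and only if there is $m>0$ such that $\varphi'(s) \leq -ms$ for a.e. $s\in (0,r_d)$.
   Context: The first Heisenberg group $\mathbb{H}$ is $\mathbb{R}^2\times\mathbb{R}$ with group law $(v,z)\cdot(v',z') := (v+v', z+z'+\omega(v,v')/2)$, where $\omega(v,v') := v_1v'_2-v_2v'_1$, and dilations $\delta_t(v,z) := (tv,t^2z)$, $t\ge 0$. A distance $d$ on $\mathbb{H}$ is homogeneous if it is left-invariant ($d(p\cdot q,p\cdot q')=d(q,q')$) and $d(\delta_t(p),\delta_t(q))=t\,d(p,q)$ for all $t>0$. A homogeneous distance $d$ is rotationally invariant if Euclidean rotations around the $z$-axis are isometries of $(\mathbb{H},d)$. Equivalently, its closed unit ball $B=\{p: d(0,p)\le1\}$ has the form $B = \{(v,z) \in \mathbb{H}: \|v\| \leq r_d,\ -\varphi(\|v\|)\le z\le \varphi(\|v\|)\}$ for some $r_d>0$ and some even function $\varphi:[-r_d,r_d]\to[0,+\infty)$ that is locally Lipschitz on $(-r_d,r_d)$; $\varphi$ is called the radial profile of $d$. Here $\|\cdot\|$ is the Euclidean norm on $\mathbb{R}^2$. ''A.e.'' and ''essentially'' refer to Lebesgue measure. BCP: in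 a metric space, balls are closed balls $B(p,r)=\{q: d(p,q)\le r\}$, $0<r<\infty$ (a ball comes with its center and radius). A family $\mathcal{B}$ of balls is a Besicovitch family if the center of each $B\in\mathcal{B}$ belongs to no other $B'\in\mathcal{B}$, $B'\ne B$, and $\bigcap_{B\in\mathcal{B}}B\neq\emptyset$. The space satisfies the Besicovitch Covering Property (BCP) if there is a constant $C\ge1$ such that $\operatorname{Card}\mathcal{B}\le C$ for every Besicovitch family $\mathcal{B}$ of balls. *)

(* Defs.v *)
From HB Require Import structures.
From mathcomp Require Import all_boot all_order all_algebra.
From mathcomp Require Import all_classical all_reals all_analysis.
Import Order.TTheory GRing.Theory Num.Theory.
Import numFieldNormedType.Exports.

Set Implicit Arguments.
Unset Strict Implicit.
Unset Printing Implicit Defensive.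

Local Open Scope classical_set_scope.
Local Open Scope ring_scope.

Record is_distance (R : realType) (T : Type) (d : T -> T -> R) : Prop := {
  dist_ge0 : forall p q, 0 <= d p q ;
  dist_eq0 : forall p q, d p q = 0 <-> p = q ;
  dist_sym : forall p q, d p q = d q p ;
  dist_triangle : forall p q s, d p s <= d p q + d q s }.

Section BCP.
Context (R : realType) (T : Type) (d : T -> T -> R).

(* A ball comes with its center and radius: it is encoded as the pair [b]
   of the two, and [cball b] is the underlying set of points. *)
Definition cball (b : T * R) : set T := [set q | d b.1 q <= b.2].

Definition besicovitch_family (F : set (T * R)) : Prop :=
  [/\ forall b, F b -> 0 < b.2,
      forall b b', F b -> F b' -> b' <> b -> ~ cball b' b.1 &
      \bigcap_(b in F) cball b !=set0].

Definition BCP : Prop :=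
  exists2 C : nat, (1 <= C)%N &
    forall F, besicovitch_family F -> (F #<= `I_C)%card.

End BCP.

(* The point (v, z) is [((v_1, v_2), z)].  The library's norm on products is
   the sup norm, hence the Euclidean norm [enorm] below. *)
Definition heis (R : realType) : Type := (R * R * R)%type.

Section Heisenberg.
Context (R : realType).
Implicit Types (p q : heis R) (v w : R * R).

Definition enorm v : R := Num.sqrt (v.1 ^+ 2 + v.2 ^+ 2).

Definition omega v w : R := v.1 * w.2 - v.2 * w.1.

Definition hmul p q : heis R :=
  ((p.1.1 + q.1.1, p.1.2 + q.1.2), p.2 + q.2 + omega p.1 q.1 / 2).

Definition horigin : heis R := ((0, 0), 0).

Definition hdil (t : R) p : heis R := ((t * p.1.1, t * p.1.2), t ^+ 2 * p.2).

Definition hrot (a : R) p : heis R :=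
  ((cos a * p.1.1 - sin a * p.1.2, sin a * p.1.1 + cos a * p.1.2), p.2).

Record homogeneous_distance (d : heis R -> heis R -> R) : Prop := {
  hom_distance : is_distance d ;
  hom_left_invariant : forall p q q', d (hmul p q) (hmul p q') = d q q' ;
  hom_dilation : forall t p q, 0 < t -> d (hdil t p) (hdil t q) = t * d p q }.

Definition rotationally_invariant (d : heis R -> heis R -> R) : Prop :=
  forall a p q, d (hrot a p) (hrot a q) = d p q.

(* [phi] is a total function, but only its values on [-r, r] are relevant. *)
Record radial_profile (d : heis R -> heis R -> R) (r : R) (phi : R -> R) :
    Prop := {
  profile_radius_gt0 : 0 < r ;
  profile_ge0 : forall s : R, `|s| <= r -> 0 <= phi s ;
  profile_even : forall s : R, `|s| <= r -> phi (- s) = phi s ;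
  profile_lipschitz : forall s : R, `|s| < r ->
    exists2 U : set R, nbhs s U & [lipschitz phi x | x in U] ;
  profile_unit_ball : cball d (horigin, 1) =
    [set p : heis R | enorm p.1 <= r /\
                     - phi (enorm p.1) <= p.2 <= phi (enorm p.1)] }.

End Heisenberg.

(* At Lebesgue-a.e. point s of D, f is differentiable and P s (f' s) holds.
   Differentiability is explicit because [derive1 f] is a total function. *)
Definition ae_derive1 (R : realType) (f : R -> R) (D : set R)
    (P : R -> R -> Prop) : Prop :=
  {ae @lebesgue_measure R, forall s : R,
     D s -> derivable f s 1 /\ P s (derive1 f s)}.

Definition ess_bounded_slope_near0 (R : realType) (phi : R -> R) : Prop :=
  exists (U : set R) (M : R), nbhs (0 : R) U /\
    ae_derive1 phi U (fun s y => `|y / s| <= M).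

Definition C1_on (R : realType) (f : R -> R) (D : set R) : Prop :=
  forall s, D s -> derivable f s 1 /\ {for s, continuous (derive1 f)}.

(* Main.v *)
(* Translating a common point of the balls to the origin and writing N for the
   distance to the origin, BCP says that families of points with
   d(p, q) > max(N p, N q) for p <> q have bounded cardinality.

   If phi'(s) > - m s at some s, the points over s (cos i eta, sin i eta, phi s),
   dilated by e^i with e small, form such a family: to first order in the ratio
   of the scales the comparison is between phi'(s) cos + (s / 2) sin and 0, where
   cos and sin are taken at multiples of eta.  The smaller m, the smaller eta can
   be, hence the larger the family.

   Conversely phi' <= - m s makes phi + m s^2 / 2 nonincreasing.  Split the group
   into finitely many dilation-invariant cones according to the sign of z, to the
   direction of v, and to whether |z| >= K |v|^2.  If p and q are in the same cone
   and N q is much smaller than N p, then q^-1 p stays in the ball of radius N p: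
   when |v| dominates, moving by - w decreases |v| linearly, and the gain in phi
   beats the symplectic term; when |v| is small compared with |w|, the vertical
   coordinate of q beats the O(|w|^2) variation of phi given by the bound on
   phi'(s) / s.  So in each cone only comparable scales occur, where points are
   separated, and compactness bounds their number.

   Almost everywhere derivatives are related to phi through the Radon-Nikodym
   density of the Stieltjes measure of a monotone Lipschitz perturbation of phi. *)
Require Import Defs.
From HB Require Import structures.
From mathcomp Require Import all_boot all_order all_algebra.
From mathcomp Require Import all_classical all_reals all_analysis.
From mathcomp Require Import measurable_realfun ring lra.
Import Order.TTheory GRing.Theory Num.Theory.
Import numFieldNormedType.Exports.
Local Open Scope classical_set_scope.
Local Open Scope ring_scope.

(** * Lipschitz functions of one real variable *)

Section absolute_continuity.
Context (R : realType).
Notation mu := (@lebesgue_measure R).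

Lemma lebesgue_stieltjes_measure_itvoc (F : cumulative R R) (x y : R) :
  x <= y -> lebesgue_stieltjes_measure F `]x, y]%classic = (F y - F x)%:E.
Proof.
move=> xy; rewrite /lebesgue_stieltjes_measure /measure_extension.
by rewrite measurable_mu_extE/= ?wlength_itv_bnd//; exact: is_ocitv.
Qed.

(** For x <= y the two hypotheses together read 0 <= f y - f x <= y - x. In this form both f and x -
    f x are distribution functions of Stieltjes measures. *)
Lemma homo_lipschitz1_right_continuous (f : R -> R) :
    {homo f : x y / x <= y} -> {homo (fun x => x - f x) : x y / x <= y} ->
  right_continuous f.
Proof.
move=> ndf ndg; apply: right_continuousW => x.
apply/cvgrPdist_le => e e0; near=> y.
have : `|x - y| <= e by near: y; apply: cvgr_dist_le.
by have [xy|/ltW xy] := leP x y; have := ndf _ _ xy; have := ndg _ _ xy;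
  rewrite !ler_norml /= => ? ? /andP[? ?]; apply/andP; split; lra.
Unshelve. all: by end_near. Qed.

(** The increments of F and H over ]x, y] add up to y - x, so by uniqueness of Lebesgue measure the
    two Stieltjes measures sum to it. *)
Lemma lebesgue_stieltjes_measure_le_lebesgue (F H : cumulative R R) :
    (forall x, F x + H x = x) ->
  forall A, measurable A ->
  (lebesgue_stieltjes_measure F A <= lebesgue_measure A)%E.
Proof.
move=> FH A mA.
rewrite (@lebesgue_measure_unique R (measure_add (lebesgue_stieltjes_measure F)
  (lebesgue_stieltjes_measure H)) _ A mA).
  by rewrite [leRHS]measure_addE leeDl.
move=> X /ocitvP[->|[[x y] /= xy ->]]; first by rewrite !measure0.
have E0 := lebesgue_stieltjes_measure_itvoc idfun _ _ (ltW xy).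
have EF := lebesgue_stieltjes_measure_itvoc F _ _ (ltW xy).
have EH := lebesgue_stieltjes_measure_itvoc H _ _ (ltW xy).
apply: (etrans E0); rewrite [RHS]measure_addE.
apply: etrans (esym (congr2 adde EF EH)).
suff -> : y - x = (F y - F x) + (H y - H x) by [].
by have := FH x; have := FH y; lra.
Qed.

(** The Stieltjes measure of f is dominated by Lebesgue measure, so it has a Radon-Nikodym density
    g. Up to a constant f is the indefinite integral of g, whose derivative is g almost
    everywhere. *)
Lemma homo_lipschitz1_density (f : R -> R) (a b : R) :
    {homo f : x y / x <= y} -> {homo (fun x => x - f x) : x y / x <= y} ->
    a < b ->
  exists g : R -> R, [/\ mu.-integrable setT (EFin \o g),
    {ae mu, forall x, x \in `]a, b[ -> derivable f x 1 /\ derive1 f x = g x} &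
    (f b - f a)%:E = (\int[mu]_(x in `]a, b]) (g x)%:E)%E ].
Proof.
move=> ndf ndg ab.
pose h x := x - f x.
have ndh : {homo (fun x => x - h x) : x y / x <= y}.
  by move=> x y xy; rewrite /h; have := ndf _ _ xy; lra.
have rcf := homo_lipschitz1_right_continuous f ndf ndg.
have rch := homo_lipschitz1_right_continuous h ndg ndh.
pose Fm := isCumulative.Build R _ R f ndf rcf.
pose F : cumulative R R := HB.pack f Fm.
pose Hm := isCumulative.Build R _ R h ndg rch.
pose H : cumulative R R := HB.pack h Hm.
pose nu : {measure set (measurableTypeR R) -> \bar R} := lebesgue_stieltjes_measure F.
have nu_le A : measurable A -> (nu A <= mu A)%E.
  by apply: (lebesgue_stieltjes_measure_le_lebesgue F H) => x; rewrite /= /h; lra.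
have nuE x y : x <= y -> nu `]x, y]%classic = (f y - f x)%:E.
  by move=> xy; exact: (lebesgue_stieltjes_measure_itvoc F _ _ xy).
have mD : measurable (`]a, b]%classic : set (measurableTypeR R)) by exact: measurable_itv.
have nuD : (nu `]a, b]%classic < +oo)%E.
  by rewrite nuE ?ltW// ltry.
(* Restricting to ]a, b] makes the measure finite, so that its density is integrable on the whole
   line. *)
pose n : {finite_measure set (measurableTypeR R) -> \bar R} := mfrestr mD nuD.
have n_mu : n `<< mu.
  apply/null_content_dominatesP => A mA A0; apply/eqP.
  rewrite -measure_le0 -A0; apply: le_trans (nu_le _ mA).
  by rewrite /n/= /mfrestr /mrestr; exact: measureIl.
pose G := Radon_Nikodym_SigmaFinite.f n mu.
have GE x : (fine (G x))%:E = G x.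
  by rewrite fineK//; exact: Radon_Nikodym_SigmaFinite.f_fin_num.
have EG : EFin \o (fine \o G) = G by apply/funext => x; exact: GE.
have intG : mu.-integrable setT (EFin \o (fine \o G)).
  by rewrite EG; exact: Radon_Nikodym_SigmaFinite.f_integrable.
have intGE A : measurable A -> (\int[mu]_(x in A) ((fine \o G) x)%:E)%E = n A.
  move=> mA; under eq_integral do rewrite /= GE.
  by rewrite -Radon_Nikodym_SigmaFinite.f_integral.
have n_itv y : a <= y <= b -> n `]a, y]%classic = (f y - f a)%:E.
  move=> /andP[ay yb]; rewrite /n/= /mfrestr /mrestr.
  rewrite (_ : _ `&` _ = `]a, y]%classic); first exact: nuE.
  apply/setIidPl => x /=; rewrite !in_itv/= => /andP[-> xy] /=.
  exact: le_trans yb.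
exists (fine \o G); split => //; last first.
  by rewrite intGE// n_itv// (ltW ab) lexx.
have intGy y : mu.-integrable [set` Interval (BRight a) (BRight y)] (EFin \o (fine \o G)).
  by apply: integrableS intG => //; exact: measurable_itv.
have := @FTC1 R (fine \o G) (BRight a) intGy (open_integrable_locally openT intG).
set P := (fun y => _) => /=.
have PE y : y \in `]a, b[ -> P y = f y - f a.
  rewrite in_itv/= => /andP[ay yb].
  by rewrite /P/= /Rintegral intGE// n_itv// !ltW.
apply: filterS; first exact: (ae_filter_ringOfSetsType mu).
move=> x + xab; have /andP[ax _] := xab.
move=> /(_ ax)[dP PG].
have fP : {near x, (fun y => P y + f a) =1 f}.
  near=> y; rewrite PE; first by rewrite subrK.
  by near: y; exact: near_in_itvoo.
have iP : is_derive x (1:R) P (fine (G x)).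
  by apply: DeriveDef; [exact: dP|rewrite -derive1E; exact: PG].
have [? ?] : is_derive x (1:R) f (fine (G x)).
  apply: near_eq_is_derive fP _.
  by rewrite -[fine _]addr0; apply: is_deriveD.
by split => //; rewrite derive1E.
Unshelve. all: by end_near. Qed.

Lemma homo_lipschitz1_ge_slope (f : R -> R) (a b c : R) :
    {homo f : x y / x <= y} -> {homo (fun x => x - f x) : x y / x <= y} ->
    a < b -> 0 <= c ->
    {ae mu, forall x, x \in `]a, b[ -> c <= derive1 f x} ->
  c * (b - a) <= f b - f a.
Proof.
move=> ndf ndg ab c0 f'c.
have [g [intg gf' gE]] := homo_lipschitz1_density _ _ _ ndf ndg ab.
have /integrableP[mg _] := intg.
have mD : measurable (`]a, b[%classic : set (measurableTypeR R)) by exact: measurable_itv.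
have mgD : measurable_fun `]a, b[ g by apply/measurable_EFinP; exact: measurable_funTS.
have mgc : measurable_fun `]a, b[ (fun x => Num.max (g x) c).
  by apply: measurable_maxr => //; exact: measurable_cst.
rewrite -lee_fin gE integral_itv_bndoo; last exact/measurable_EFinP.
(* Almost everywhere g equals max(g, c), and the latter is at least c at every point, as the
   comparison of integrals requires. *)
rewrite (@ae_eq_integral _ _ _ mu _ (fun x => (Num.max (g x) c)%:E)) //; last 3 first.
- exact/measurable_EFinP.
- exact/measurable_EFinP.
- apply: (filterS2 _ _ f'c gf'); first exact: (ae_filter_ringOfSetsType mu).
  by move=> x cf' fg xab; rewrite max_l//; have [_ <-] := fg xab; exact: cf'.
rewrite (_ : (c * (b - a))%:E = \int[mu]_(x in `]a, b[) c%:E)%E; last first.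
  rewrite integral_cst//= EFinM; congr (_ * _)%E.
  by rewrite lebesgue_measure_itv/= lte_fin ab.
apply: ge0_le_integral => //.
- exact/measurable_EFinP.
- by move=> x _; rewrite lee_fin le_max lexx orbT.
Qed.

(** Adding L x to f gives slopes between 0 and 2 L; division by 2 L + 1 makes the result
    nondecreasing and 1-Lipschitz. If f' >= 0 almost everywhere, the rescaled function has slope at
    least c L, which integrates to f a <= f b. *)
Lemma lipschitz_ae_derivable_monotone (f : R -> R) (a b L : R) :
    a < b -> 0 <= L ->
    (forall x y, x \in `[a, b] -> y \in `[a, b] -> `|f x - f y| <= L * `|x - y|) ->
  {ae mu, forall x, x \in `]a, b[ -> derivable f x 1} /\
  ({ae mu, forall x, x \in `]a, b[ -> 0 <= derive1 f x} -> f a <= f b).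
Proof.
move=> ab L0 lipf.
pose c := (2 * L + 1)^-1.
have c0 : 0 < c by rewrite invr_gt0; lra.
have cE : c * (2 * L + 1) = 1 by rewrite mulVf//; apply: lt0r_neq0; lra.
(* Clamping to [a, b] extends f to the whole line without losing the Lipschitz bound. *)
pose k x := Num.max a (Num.min x b).
have kab x : k x \in `[a, b].
  by rewrite in_itv/= /k le_max lexx/= ge_max (ltW ab) ge_min lexx orbT.
have kE x : x \in `[a, b] -> k x = x.
  by rewrite in_itv/= => /andP[ax xb]; rewrite /k min_l// max_r.
have kle x y : x <= y -> 0 <= k y - k x <= y - x.
  by rewrite /k /Num.max /Num.min; do !case: ifPn; rewrite -?leNgt; lra.
pose h x := c * (f (k x) + L * k x).
have lipk x y : x <= y -> - L * (k y - k x) <= f (k y) - f (k x) <= L * (k y - k x).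
  move=> /kle /andP[xy _].
  by have := lipf _ _ (kab y) (kab x); rewrite ler_norml (ger0_norm xy) mulNr.
have ndh : {homo h : x y / x <= y}.
  move=> x y xy; rewrite /h ler_pM2l//.
  by have := lipk _ _ xy; lra.
have ndh' : {homo (fun x => x - h x) : x y / x <= y}.
  move=> x y xy; have : h y - h x <= y - x; last by lra.
  have /andP[k0 kyx] := kle _ _ xy; apply: le_trans kyx.
  rewrite /h -mulrBr -[leRHS]mul1r -cE -mulrA ler_pM2l//.
  by have := lipk _ _ xy; nra.
have fE x : x \in `]a, b[ -> {near x, (fun y => c^-1 * h y - L * y) =1 f}.
  move=> xab; near=> y.
  have /kE ky : y \in `[a, b].
    by apply: subset_itv_oo_cc; near: y; exact: near_in_itvoo.
  by rewrite /h ky mulKf ?addrK// gt_eqF.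
have dfE x : x \in `]a, b[ -> derivable h x 1 ->
    is_derive x (1:R) f (c^-1 * derive1 h x - L).
  move=> xab dh; apply: near_eq_is_derive (fE _ xab) _.
  have ? : is_derive x (1:R) h (derive1 h x).
    by apply: DeriveDef => //; rewrite derive1E.
  apply: is_derive_eq; rewrite ?scaler0 ?addr0 ?add0r.
  by rewrite /GRing.scale/= mulr1.
have [g [_ gh _]] := homo_lipschitz1_density _ _ _ ndh ndh' ab.
have fmu := ae_filter_ringOfSetsType mu.
have dh : {ae mu, forall x, x \in `]a, b[ -> derivable h x 1}.
  by apply: filterS gh => // x + xab => /(_ xab)[].
split.
  by apply: filterS dh => // x dhx xab; have [] := dfE _ xab (dhx xab).
move=> df.
have f'c :
    {ae mu, forall x, x \in `]a, b[ -> c * L <= derive1 h x}.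
  apply: (filterS2 _ _ dh df) => x dhx dfx xab.
  have [_] := dfE _ xab (dhx xab); rewrite -derive1E => fx.
  have := dfx xab; rewrite fx subr_ge0 => Lh.
  by have := ler_wpM2l (ltW c0) Lh; rewrite mulVKf// gt_eqF.
have := homo_lipschitz1_ge_slope _ _ _ _ ndh ndh' ab (mulr_ge0 (ltW c0) L0) f'c.
rewrite /h !kE ?in_itv/= ?lexx ?(ltW ab)// -mulrBr -mulrA ler_pM2l//.
by lra.
Unshelve. all: by end_near. Qed.

Lemma lipschitz_onP (f : R -> R) (U : set R) : [lipschitz f x | x in U] ->
  exists2 M, 0 <= M & forall x y, U x -> U y -> `|f x - f y| <= M * `|x - y|.
Proof.
move=> lipf; near (pinfty_nbhs R) => M.
exists M => [//|x y Ux Uy].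
suff /(_ (x, y)) : M.-lipschitz_U f by apply.
by near: M.
Unshelve. all: by end_near. Qed.

(** Take the supremum c of the endpoints up to which f is Lipschitz: the local constant at c carries
    the property beyond c, unless c = b. *)
Lemma locally_lipschitz_segment (f : R -> R) (a b : R) : a <= b ->
    (forall s, s \in `[a, b] -> exists2 U, nbhs s U & [lipschitz f x | x in U]) ->
  exists2 L, 0 <= L &
    forall x y, x \in `[a, b] -> y \in `[a, b] -> `|f x - f y| <= L * `|x - y|.
Proof.
move=> ab locf.
have loc s : s \in `[a, b] -> exists e L, [/\ 0 < e, 0 <= L &
    forall x y, `|s - x| < e -> `|s - y| < e -> `|f x - f y| <= L * `|x - y|].
  move=> /locf[U /nbhs_ballP[e /= e0 eU] /lipschitz_onP[L L0 lip]].
  by exists e, L; split => // x y /eU ? /eU ?; exact: lip.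
pose lip c := exists2 L, 0 <= L &
  forall x y, a <= x -> x <= y -> y <= c -> `|f x - f y| <= L * (y - x).
pose S := [set c | a <= c <= b /\ lip c].
have Sa : S a.
  split; first by rewrite lexx.
  exists 0 => // x y ax xy ya; have -> : x = y by lra.
  by rewrite !subrr normr0 mul0r.
have supS : has_sup S by split; [exists a|exists b => c [/andP[]]].
pose c := sup S.
have ac : a <= c by apply: ub_le_sup => //; exact: supS.2.
have cb : c <= b by apply: ge_sup => [|x [/andP[]]] //; exists a.
have [e [L [e0 L0 lipc]]] : exists e L, [/\ 0 < e, 0 <= L &
    forall x y, `|c - x| < e -> `|c - y| < e -> x <= y -> `|f x - f y| <= L * (y - x)].
  have [|e [L [e0 L0 lipc]]] := loc c; first by rewrite in_itv/= ac.
  exists e, L; split => // x y xe ye xy.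
  by rewrite -(ger0_norm (_ : 0 <= y - x)) ?subr_ge0// (distrC y); exact: lipc.
have [x [/andP[ax xb] [L' L'0 lipx]] cx] := sup_adherent e0 supS.
rewrite -/c in cx.
have xc : x <= c by apply: ub_le_sup; [exact: supS.2|split; [rewrite ax|exists L']].
pose c' := Num.min b (c + e / 2).
have c'b : c' <= b by rewrite ge_min lexx.
have c'e : c' <= c + e / 2 by rewrite ge_min lexx orbT.
have cc' : c <= c' by rewrite le_min cb/=; lra.
have lipc' : lip c'.
  exists (L + L') => [|y z ay yz zc']; first exact: addr_ge0.
  have near_c w : x <= w -> w <= c' -> `|c - w| < e.
    by move=> xw wc'; rewrite ltr_norml; apply/andP; split; lra.
  have [zx|/ltW xz] := leP z x.
    by apply: le_trans (lipx _ _ ay yz zx) _; apply: ler_wpM2r; lra.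
  have [xy|/ltW yx] := leP x y.
    have := lipc y z (near_c _ xy (le_trans yz zc')) (near_c _ xz zc') yz.
    by move=> /le_trans; apply; apply: ler_wpM2r; lra.
  have h1 := lipc x z (near_c _ (lexx x) (le_trans xz zc')) (near_c _ xz zc') xz.
  have h2 := lipx y x ay yx (lexx x).
  (* A pair straddling x is split at x, hence the constant L + L'. *)
  have -> : f y - f z = (f y - f x) + (f x - f z) by lra.
  by apply: (le_trans (ler_normD _ _)); nra.
have c'c : c' <= c.
  by apply: ub_le_sup; [exact: supS.2|split => //; rewrite c'b (le_trans ac)].
have bc' : b = c'.
  apply/eqP; rewrite eq_le c'b andbT leNgt; apply/negP => c'ltb.
  by move: c'ltb c'c; rewrite /c' /Num.min; case: ifPn; rewrite -?leNgt; lra.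
have [K K0 lipb] := lipc'; rewrite -bc' in lipb.
exists K => // y z; rewrite !in_itv/= => /andP[ay yb] /andP[az zb].
have [yz|/ltW zy] := leP y z.
  by rewrite [X in _ * X]distrC (ger0_norm (_ : 0 <= z - y)) ?subr_ge0//; exact: lipb.
by rewrite distrC (ger0_norm (_ : 0 <= y - z)) ?subr_ge0//; exact: lipb.
Qed.

(** The intervals from a + 1/(n+1) to b - 1/(n+1) exhaust ]a, b[, and f is Lipschitz on each; only
    countably many null sets are discarded. *)
Lemma locally_lipschitz_ae_derivable (f : R -> R) (a b : R) :
    (forall s, s \in `]a, b[ -> exists2 U, nbhs s U & [lipschitz f x | x in U]) ->
  {ae mu, forall x, x \in `]a, b[ -> derivable f x 1}.
Proof.
move=> locf; have fmu := ae_filter_ringOfSetsType mu.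
have aen n : {ae mu, forall x, x \in `](a + n.+1%:R^-1), (b - n.+1%:R^-1)[ ->
    derivable f x 1}.
  have [ab|ba] := ltP (a + n.+1%:R^-1) (b - n.+1%:R^-1); last first.
    apply: aeW => x; rewrite in_itv/= => /andP[ax xb].
    by have := lt_trans ax xb; rewrite ltNge ba.
  have [|L L0 lip] := locally_lipschitz_segment f _ _ (ltW ab).
    move=> s; rewrite in_itv/= => /andP[sa sb]; apply: locf; rewrite in_itv/=.
    have n0 : 0 < n.+1%:R^-1 :> R by [].
    by move: (n.+1%:R^-1) n0 sa sb => e ? ? ?; apply/andP; split; lra.
  exact: (lipschitz_ae_derivable_monotone f _ _ L ab L0 lip).1.
have := ae_foralln aen.
apply: filterS => x aex; rewrite in_itv/= => /andP[ax xb].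
have d0 : 0 < Num.min (x - a) (b - x).
  by rewrite lt_min; apply/andP; split; lra.
near \oo => n; apply: (aex n); rewrite in_itv/=.
have : n.+1%:R^-1 < Num.min (x - a) (b - x).
  by near: n; exact: (near_infty_natSinv_lt (PosNum d0)).
by rewrite lt_min => /andP[]; move: (n.+1%:R^-1) => e ? ?; apply/andP; split; lra.
Unshelve. all: by end_near. Qed.

(** The function k f + m x^2 / 2 has derivative k f' + m x. The factor k serves both directions: k =
    -1 for upper bounds on the slope, k = 1 for lower bounds. *)
Lemma locally_lipschitz_ae_quadratic_monotone (f : R -> R) (a b k m : R) : a <= b ->
    (forall s, s \in `[a, b] -> exists2 U, nbhs s U & [lipschitz f x | x in U]) ->
    {ae mu, forall x, x \in `]a, b[ -> derivable f x 1 /\ 0 <= k * derive1 f x + m * x} ->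
  k * f a + m / 2 * a ^+ 2 <= k * f b + m / 2 * b ^+ 2.
Proof.
rewrite le_eqVlt => /predU1P[->//|ab] locf aef.
have fmu := ae_filter_ringOfSetsType mu.
have [L L0 lip] := locally_lipschitz_segment f _ _ (ltW ab) locf.
pose g x := k * f x + m / 2 * x ^+ 2.
pose K := `|k| * L + `|m| / 2 * (`|a| + `|b|) * 2.
have abE x : x \in `[a, b] -> `|x| <= `|a| + `|b|.
  rewrite in_itv/= => /andP[ax xb]; rewrite ler_norml.
  have := ler_norm b; have := ler_norm (- a); rewrite normrN => ? ?.
  by have := normr_ge0 a; have := normr_ge0 b; move=> ? ?; apply/andP; split; lra.
have K0 : 0 <= K by rewrite /K !(addr_ge0, mulr_ge0).
have lipg x y : x \in `[a, b] -> y \in `[a, b] -> `|g x - g y| <= K * `|x - y|.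
  move=> xab yab.
  have -> : g x - g y = k * (f x - f y) + m / 2 * ((x + y) * (x - y)).
    by rewrite /g; field.
  apply: (le_trans (ler_normD _ _)); rewrite /K [leRHS]mulrDl; apply: lerD.
    by rewrite normrM -mulrA ler_wpM2l//; exact: lip.
  rewrite !normrM (ger0_norm (_ : 0 <= 2^-1)) ?invr_ge0// mulrA.
  apply: ler_wpM2r => //; rewrite -!mulrA; apply: ler_wpM2l => //.
  apply: ler_wpM2l; first by rewrite invr_ge0.
  apply: (le_trans (ler_normD _ _)).
  by have := abE _ xab; have := abE _ yab; lra.
apply: (lipschitz_ae_derivable_monotone g _ _ K ab K0 lipg).2.
apply: filterS aef => x + xab => /(_ xab)[df].
have ? : is_derive x (1:R) f (derive1 f x).
  by apply: DeriveDef => //; rewrite derive1E.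
suff [_] : is_derive x (1:R) g (k * derive1 f x + m * x) by rewrite -derive1E => ->.
by apply: is_derive_eq; rewrite /GRing.scale/=; field.
Qed.

End absolute_continuity.

(** * Slope at the origin of an even C^1 profile *)

Lemma derive1_even0 (R : realType) (f : R -> R) :
  {near 0, (fun x => f (- x)) =1 f} -> derivable f 0 1 -> derive1 f 0 = 0.
Proof.
move=> evf df.
have df0 : is_derive (0 : R) (1 : R) f (derive1 f 0).
  by apply: DeriveDef => //; rewrite derive1E.
have df0' : is_derive (- 0 : R) (1 : R) f (derive1 f 0) by rewrite oppr0.
have [_] : is_derive (0 : R) (1 : R) f (- derive1 f 0).
  apply: near_eq_is_derive evf _.
  have -> : (fun x => f (- x)) = f \o -%R by [].
  by apply: is_derive_eq; rewrite /GRing.scale/=; ring.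
by rewrite -derive1E; lra.
Qed.

Lemma derivable_bounded_slope (R : realType) (f : R -> R) :
  derivable f 0 1 -> f 0 = 0 -> exists M : R, \forall s \near (0 : R), `|f s / s| <= M.
Proof.
move=> df f0; have /cvg_ex[l fl] := df.
have l1 : `|l| < `|l| + 1 by rewrite ltrDl.
have := cvgr_norm_le l fl _ l1; rewrite near_withinE => ls.
exists (`|l| + 1); near=> s.
have [->|s0] := eqVneq s 0; first by rewrite f0 mul0r normr0 ltW// ltr_wpDl.
have : s != 0 -> `|s^-1 *: (f (s *: (1 : R) + 0) - f 0)| <= `|l| + 1 by near: s; exact: ls.
by move=> /(_ s0); rewrite f0 subr0 addr0 /GRing.scale/= mulr1 mulrC.
Unshelve. all: by end_near. Qed.

(** Evenness gives phi'(0) = 0, so phi'(s) / s is a difference quotient of phi' at 0 and stays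
    bounded near 0. *)
Lemma C1_ess_bounded_slope (R : realType) (d : heis R -> heis R -> R)
    (r : R) (phi : R -> R) (hphi : radial_profile d r phi) :
  C1_on phi `](- r), r[ -> derivable (derive1 phi) 0 1 ->
  ess_bounded_slope_near0 phi.
Proof.
move=> phiC1 dphi'; have r0 := profile_radius_gt0 hphi.
have rE s : `](- r), r[%classic s = (`|s| < r) by rewrite /= in_itv/= ltr_norml.
have dphi0 : derivable phi 0 1 by apply: (phiC1 _ _).1; rewrite rE normr0.
have near_r : \forall s \near (0 : R), `|s| < r.
  near=> s; rewrite -[s]subr0 distrC; near: s.
  exact: cvgr_dist_lt.
have phi'0 : derive1 phi 0 = 0.
  apply: derive1_even0 dphi0; near=> s; apply: (profile_even hphi).
  by apply: ltW; near: s.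
have [M phiM] := derivable_bounded_slope _ _ dphi' phi'0.
exists [set s | `|s| < r /\ `|derive1 phi s / s| <= M], M; split.
  exact: filterI.
apply: aeW => s [sr sM]; split; last exact: sM.
by apply: (phiC1 _ _).1; rewrite rE.
Unshelve. all: by end_near. Qed.

(** * Balls in the Heisenberg group *)

Section heisenberg_basics.
Context (R : realType).
Implicit Types (p q : heis R) (d : heis R -> heis R -> R).

Lemma enorm_ge0 (v : R * R) : 0 <= enorm v.
Proof. exact: sqrtr_ge0. Qed.

Lemma enorm_sqr (v : R * R) : enorm v ^+ 2 = v.1 ^+ 2 + v.2 ^+ 2.
Proof. by rewrite sqr_sqrtr// addr_ge0// sqr_ge0. Qed.

Lemma enormZ (t : R) (v : R * R) : 0 <= t -> enorm (t * v.1, t * v.2) = t * enorm v.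
Proof.
move=> t0; rewrite /enorm/= !exprMn -mulrDr sqrtrM ?sqr_ge0//.
by rewrite sqrtr_sqr ger0_norm.
Qed.

(** The group element p^-1 q in coordinates. *)
Definition hsubl p q : heis R :=
  ((q.1.1 - p.1.1, q.1.2 - p.1.2), q.2 - p.2 - omega p.1 q.1 / 2).

Context (d : heis R -> heis R -> R) (hd : homogeneous_distance d).

Lemma dist_hsubl p q : d p q = d (horigin R) (hsubl p q).
Proof.
rewrite -(hom_left_invariant hd ((- p.1.1, - p.1.2), - p.2) p q).
move: p q => [[a b] c] [[a' b'] c']; rewrite /hmul /hsubl /horigin /omega/=.
by congr d; congr (_, _, _); field.
Qed.

Lemma dist_hdil0 (t : R) p : 0 < t -> d (horigin R) (hdil t p) = t * d (horigin R) p.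
Proof.
move=> t0; rewrite -(hom_dilation hd)//; congr d.
by rewrite /hdil /horigin/= !mulr0.
Qed.

Context (r : R) (phi : R -> R) (hphi : radial_profile d r phi).

Lemma dist0_le1 p : d (horigin R) p <= 1 <->
  enorm p.1 <= r /\ - phi (enorm p.1) <= p.2 <= phi (enorm p.1).
Proof.
have /(congr1 (fun A => A p)) /= := profile_unit_ball hphi.
by rewrite /cball/= => ->.
Qed.

Lemma dist0_le (t : R) p : 0 < t -> d (horigin R) p <= t <->
  enorm p.1 <= t * r /\ `|p.2| <= t ^+ 2 * phi (enorm p.1 / t).
Proof.
move=> t0.
have -> : (d (horigin R) p <= t) = (d (horigin R) (hdil t^-1 p) <= 1).
  by rewrite dist_hdil0 ?invr_gt0// ler_pdivrMl// mulr1.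
rewrite dist0_le1 /= enormZ ?invr_ge0 ?(ltW t0)// (mulrC t^-1).
rewrite ler_pdivrMr// (mulrC r) -ler_norml normrM ger0_norm; last first.
  by rewrite exprn_ge0// invr_ge0 ltW.
by rewrite exprVn ler_pdivrMl ?exprn_gt0.
Qed.

End heisenberg_basics.
Arguments hsubl {R} p q.

(** * BCP forces a negative slope *)

Lemma is_derive_gt0_near (R : realType) (F : R -> R) (l : R) :
  is_derive (0 : R) (1 : R) F l -> F 0 = 0 -> 0 < l -> \forall x \near 0^'+, 0 < F x.
Proof.
move=> [dF Fl] F0 l0.
have Fcvg : (h^-1 *: (F (h *: (1 : R) + 0) - F 0)) @[h --> 0^'] --> l by rewrite -Fl.
have := cvgr_gt l Fcvg 0 l0; rewrite near_withinE => Fh.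
rewrite near_withinE; near=> x => x0.
have : x != 0 -> 0 < x^-1 *: (F (x *: (1 : R) + 0) - F 0) by near: x; exact: Fh.
rewrite gt_eqF// F0 subr0 addr0 /GRing.scale/= mulr1 => /(_ isT).
by rewrite pmulr_rgt0// invr_gt0.
Unshelve. all: by end_near. Qed.

Lemma near_forall_ltn (T : Type) (F : set_system T) (FF : Filter F) (n : nat)
    (P : nat -> T -> Prop) :
  (forall k, (k < n)%N -> \forall x \near F, P k x) ->
  \forall x \near F, forall k, (k < n)%N -> P k x.
Proof.
elim: n => [|n IHn] FP; first by near=> x.
have [Pn Pk] : (\forall x \near F, P n x) /\
    \forall x \near F, forall k, (k < n)%N -> P k x.
  by split; [exact: FP|apply: IHn => k kn; apply: FP; exact: ltnW].
near=> x; move=> k; rewrite ltnS leq_eqVlt => /predU1P[->|kn]; first by near: x.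
by move: k kn; near: x.
Unshelve. all: by end_near. Qed.

(** The difference of the two sides vanishes at e = 0 and has derivative s (phi'(s) c + s sn / 2) >
    0 there. When c and sn are the cosine and sine of an angle, the argument of phi is |v - e w| for
    vectors of norm s at that angle, and the last term is half the symplectic form. *)
Lemma profile_slope_near (R : realType) (phi : R -> R) (s c sn : R) :
    0 < s -> derivable phi s 1 -> 0 < derive1 phi s * c + s * sn / 2 ->
  \forall e \near 0^'+, phi (s * Num.sqrt (1 - 2 * e * c + e ^+ 2)) <
    phi s - e ^+ 2 * phi s + e * s ^+ 2 * sn / 2.
Proof.
move=> s0 dphi hpos.
pose q (e : R) := 1 - 2 * e * c + e ^+ 2.
pose u e := s * Num.sqrt (q e).
pose F e := phi s - e ^+ 2 * phi s + e * s ^+ 2 * sn / 2 - phi (u e).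
have q0 : q 0 = 1 by rewrite /q; ring.
have u0 : u 0 = s by rewrite /u q0 sqrtr1 mulr1.
have dq : is_derive (0 : R) (1 : R) q (- 2 * c).
  by apply: is_derive_eq; rewrite /GRing.scale/=; ring.
have dsq : is_derive (q 0) (1 : R) Num.sqrt (2 * Num.sqrt (q 0))^-1.
  by apply: is_derive1_sqrt; rewrite q0.
have du : is_derive (0 : R) (1 : R) u (- s * c).
  have -> : u = (fun e => s * (Num.sqrt \o q) e) by [].
  by apply: is_derive_eq; rewrite q0 sqrtr1 /GRing.scale/=; field.
have dphi' : is_derive (u 0) (1 : R) phi (derive1 phi s).
  by rewrite u0; apply: DeriveDef => //; rewrite derive1E.
have dF : is_derive (0 : R) (1 : R) F (s * (derive1 phi s * c + s * sn / 2)).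
  have -> : F = (fun e =>
    phi s - e ^+ 2 * phi s + e * s ^+ 2 * sn / 2 - (phi \o u) e) by [].
  by apply: is_derive_eq; rewrite /GRing.scale/=; field.
have /(is_derive_gt0_near _ _ _ dF) : F 0 = 0 by rewrite /F u0; ring.
rewrite mulr_gt0// => /(_ isT).
by apply: filterS => e; rewrite /F subr_gt0.
Qed.

(** The number m depends only on the constant C of BCP: a point s with phi'(s) > - m s would produce
    a Besicovitch family of C + 1 balls. *)
Lemma BCP_slope_bound (R : realType) (d : heis R -> heis R -> R) (r : R)
    (phi : R -> R) (hd : homogeneous_distance d) (hphi : radial_profile d r phi) :
  BCP d -> exists2 m : R, 0 < m & forall s, s \in `]0, r[ ->
    derivable phi s 1 -> derive1 phi s <= - m * s.
Proof.
move=> [C _ bcp].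
(* All differences n eta with 0 < n <= C lie in ]0, pi / 2[, where sine is positive and cosine
   nonnegative. *)
pose eta : R := pi / (2 * C.+1%:R).
have C0 : 0 < C.+1%:R :> R by [].
have eta0 : 0 < eta by rewrite divr_gt0 ?pi_gt0// mulr_gt0.
have th_itv n : (0 < n)%N -> (n < C.+1)%N -> 0 < n%:R * eta < pi / 2.
  move=> n0 nC; rewrite mulr_gt0 ?ltr0n//= /eta.
  have -> : n%:R * (pi / (2 * C.+1%:R)) = n%:R / C.+1%:R * (pi / 2) :> R.
    by rewrite invfM; ring.
  by rewrite gtr_pMl ?divr_gt0 ?pi_gt0// ltr_pdivrMr// mul1r ltr_nat.
have [m m0 msin] : exists2 m, 0 < m & forall n, (n < C.+1)%N -> (0 < n)%N ->
    2 * m < sin (n%:R * eta).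
  have : \forall m \near 0^'+, forall n, (n < C.+1)%N -> (0 < n)%N ->
      2 * m < sin (n%:R * eta).
    apply: near_forall_ltn => n nC; have [->|n0] := posnP n; first by near=> m.
    have s0 : 0 < sin (n%:R * eta) / 2 by rewrite divr_gt0// sin_gt0_pihalf// th_itv.
    by apply: filterS (nbhs_right_lt s0) => m mlt _; lra.
  move=> nearm; near (0 : R)^'+ => m.
  by exists m => //; near: m.
exists m => // s; rewrite in_itv/= => /andP[s0 sr] dphi.
rewrite leNgt; apply/negP => slope.
(* One e must serve all differences n eta and all ratios x <= e, since the points i < j of the
   family have scale ratio e^(j - i). *)
have [e [e0 e1 eP]] : exists e, [/\ 0 < e, e < 1 & forall n x, (n < C.+1)%N -> (0 < n)%N ->
    0 < x -> x <= e ->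
    phi (s * Num.sqrt (1 - 2 * x * cos (n%:R * eta) + x ^+ 2)) <
    phi s - x ^+ 2 * phi s + x * s ^+ 2 * sin (n%:R * eta) / 2].
  have : \forall x \near 0^'+, forall n, (n < C.+1)%N -> (0 < n)%N ->
    phi (s * Num.sqrt (1 - 2 * x * cos (n%:R * eta) + x ^+ 2)) <
    phi s - x ^+ 2 * phi s + x * s ^+ 2 * sin (n%:R * eta) / 2.
    apply: near_forall_ltn => n nC; have [->|n0] := posnP n; first by near=> x.
    have /andP[th0 th1] := th_itv _ n0 nC.
    (* The first term is at least - m s because the cosine lies in [0, 1]; the second exceeds m s by
       the choice of m. *)
    have : 0 < derive1 phi s * cos (n%:R * eta) + s * sin (n%:R * eta) / 2.
      have c0 : 0 <= cos (n%:R * eta).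
        by apply: cos_ge0_pihalf; apply/andP; split; have := @pi_gt0 R; lra.
      have c1 := cos_le1 (n%:R * eta).
      have h1 := ler_wpM2r c0 (ltW slope).
      have h2 : m * s * cos (n%:R * eta) <= m * s by rewrite ler_piMr// mulr_ge0 ?ltW.
      have h3 : s * (2 * m) < s * sin (n%:R * eta) by rewrite ltr_pM2l// msin.
      lra.
    move=> /(profile_slope_near _ _ _ _ _ s0 dphi).
    by apply: filterS => x Px.
  rewrite near_withinE => /nbhs_ballP[e0 /= e00 eP].
  pose e := Num.min e0 1 / 2.
  have em : 0 < Num.min e0 1 by rewrite lt_min e00/=.
  have ee0 : Num.min e0 1 <= e0 by rewrite ge_min lexx.
  have e1 : Num.min e0 1 <= 1 by rewrite ge_min lexx orbT.
  exists e; split; rewrite /e; [lra|lra|].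
  move=> n x nC n0 x0 xe; apply: (eP x) => //=.
  by rewrite /ball/= sub0r normrN gtr0_norm//; lra.
pose Q (i : nat) : heis R := ((s * cos (i%:R * eta), s * sin (i%:R * eta)), phi s).
have ei0 i : 0 < e ^+ i by rewrite exprn_gt0.
have ltei i j : (i < j)%N -> e ^+ j < e ^+ i by move=> ij; rewrite ltr_iXn2l.
pose pt (i : nat) : heis R := hdil (e ^+ i) (Q i).
have enormQ x : enorm (s * cos x, s * sin x) = s.
  by rewrite (enormZ _ s (cos x, sin x) (ltW s0)) /enorm/= cos2Dsin2 sqrtr1 mulr1.
(* The larger radius of the two balls is e^i, so this bound keeps each centre out of the other ball.
   After dilation by e^(-i), the height of the difference exceeds the profile. *)
have ptE i j : (i < j)%N -> (j < C.+1)%N -> e ^+ i < d (pt j) (pt i).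
  move=> ij jC; pose x := e ^+ (j - i).
  have -> : pt j = hdil (e ^+ i) (hdil x (Q j)).
    have ej : e ^+ j = e ^+ i * x by rewrite -exprD subnKC// ltnW.
    by rewrite /pt ej /hdil/=; congr (_, _, _); ring.
  rewrite (hom_dilation hd)// -[ltLHS]mulr1 ltr_pM2l//.
  rewrite ltNge; apply/negP; rewrite (dist_hsubl _ _ hd).
  move=> /(dist0_le1 _ _ _ _ hphi)[_ /andP[_]].
  have ji0 : (0 < j - i)%N by rewrite subn_gt0.
  have jiC : (j - i < C.+1)%N by rewrite (leq_ltn_trans _ jC)// leq_subr.
  have x0 : 0 < x by exact: ei0.
  have xe : x <= e by rewrite /x -[leRHS]expr1 ler_wiXn2l// ltW.
  have := eP _ _ jiC ji0 x0 xe.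
  have -> : (j - i)%:R * eta = j%:R * eta - i%:R * eta by rewrite natrB ?(ltnW ij)//; ring.
  rewrite cosB sinB /hsubl /omega /=.
  have := cos2Dsin2 (j%:R * eta); have := cos2Dsin2 (i%:R * eta).
  move: (cos (j%:R * eta)) (sin (j%:R * eta)) (cos (i%:R * eta)) (sin (i%:R * eta)).
  move=> cj sj ci si i1 j1.
  have -> : s * Num.sqrt (1 - 2 * x * (cj * ci + sj * si) + x ^+ 2) =
      enorm (s * ci - x * (s * cj), s * si - x * (s * sj)).
    rewrite -[X in X * _](ger0_norm (ltW s0)) -sqrtr_sqr -sqrtrM ?sqr_ge0// /enorm/=.
    congr Num.sqrt.
    transitivity (s ^+ 2 * ((ci ^+ 2 + si ^+ 2) - 2 * x * (cj * ci + sj * si) +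
      x ^+ 2 * (cj ^+ 2 + sj ^+ 2))); last by ring.
    by rewrite i1 j1; ring.
  lra.
pose F := [set (pt i, e ^+ i) | i in `I_C.+1].
have cardF : (F #= `I_C.+1)%card.
  apply: inj_card_eq => i j _ _ [_ _ _ eij].
  by have [/ltei|/ltei|//] := ltngtP i j; rewrite eij ltxx.
have /bcp : besicovitch_family d F.
  split.
  - by move=> _ [i _ <-]/=.
  - move=> _ _ [i /= iC <-] [j /= jC <-] ji; rewrite /cball/= => dji.
    have [ij|ij|ij] := ltngtP i j; last by apply: ji; rewrite ij.
      by have := lt_trans (ltei _ _ ij) (ptE _ _ ij jC); rewrite ltNge dji.
    by have := ptE _ _ ij iC; rewrite (dist_sym (hom_distance hd)) ltNge dji.
  - exists (horigin R) => _ [i _ <-]; rewrite /cball/=.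
    rewrite (dist_sym (hom_distance hd)) (dist_hdil0 _ _ hd)// -[leRHS]mulr1 ler_pM2l//.
    apply/(dist0_le1 _ _ _ _ hphi); rewrite /= enormQ ?(ltW sr)// lexx andbT; split => //.
    have := profile_ge0 hphi (s := s); rewrite gtr0_norm// => /(_ (ltW sr)); lra.
by rewrite (card_le_eql cardF) card_le_II ltnn.
Unshelve. all: by end_near. Qed.

(** * A negative slope implies BCP *)

Section sufficiency.
Context (R : realType) (d : heis R -> heis R -> R) (r : R) (phi : R -> R).
Hypotheses (hd : homogeneous_distance d) (hphi : radial_profile d r phi).

(** Dilation by t <= 1 keeps the point (s, 0, phi s) in the unit ball. *)
Lemma profile_scaling (t s : R) : 0 < t -> t <= 1 -> 0 <= s -> s <= r ->
  t ^+ 2 * phi s <= phi (t * s).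
Proof.
move=> t0 t1 s0 sr.
have phis : 0 <= phi s by apply: (profile_ge0 hphi); rewrite ger0_norm.
have es : enorm (s, 0 : R) = s by rewrite /enorm/= expr0n addr0 sqrtr_sqr ger0_norm.
have : d (horigin R) ((s, 0), phi s) <= 1.
  by apply/(dist0_le1 _ _ _ _ hphi); rewrite /= es lexx andbT; split => //; lra.
move=> /(ler_wpM2l (ltW t0)); rewrite mulr1 => /le_trans/(_ t1).
rewrite -(dist_hdil0 _ _ hd)// => /(dist0_le1 _ _ _ _ hphi)[_ /=].
by rewrite (enormZ _ t (s, 0) (ltW t0)) es => /andP[].
Qed.

Section decreasing_profile.
Context (m : R).
Hypotheses (m0 : 0 < m) (aephi : ae_derive1 phi `]0, r[ (fun s y => y <= - m * s)).

(** On [0, r[ this integrates the bound on phi'. The Lipschitz hypothesis stops short of r, and the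
    endpoint is reached through [profile_scaling], which gives phi u >= (u / r)^2 phi r. *)
Lemma profile_decr_quadratic (s t : R) : 0 <= s -> s <= t -> t <= r ->
  phi t + m / 2 * t ^+ 2 <= phi s + m / 2 * s ^+ 2.
Proof.
have lt_case u v : 0 <= u -> u <= v -> v < r ->
    phi v + m / 2 * v ^+ 2 <= phi u + m / 2 * u ^+ 2.
  move=> u0 uv vr.
  have := locally_lipschitz_ae_quadratic_monotone _ phi u v (-1) (- m) uv _ _.
  move=> H.
  have : -1 * phi u + - m / 2 * u ^+ 2 <= -1 * phi v + - m / 2 * v ^+ 2; last by lra.
  apply: H => [x|].
    rewrite in_itv/= => /andP[ux xv]; apply: (profile_lipschitz hphi).
    by rewrite ger0_norm; lra.
  apply: filterS aephi; first exact: (ae_filter_ringOfSetsType (@lebesgue_measure R)).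
  move=> x + xuv => /(_ _)[|dx phix].
    by move: xuv; rewrite /= !in_itv/= => /andP[? ?]; apply/andP; split; lra.
  by split => //; lra.
move=> s0; rewrite le_eqVlt => /predU1P[->//|st].
rewrite le_eqVlt => /predU1P[tr|]; last exact/lt_case/ltW.
rewrite {t}tr in st *.
have r0 : 0 < r by lra.
have phir : 0 <= phi r by apply: (profile_ge0 hphi); rewrite gtr0_norm.
pose A := phi s + m / 2 * s ^+ 2.
(* With this K the value at the endpoint is r^2 K, and u^2 K <= A holds for u < r; it remains to let
   u tend to r. *)
pose K := phi r / r ^+ 2 + m / 2.
have K0 : 0 < K by apply: ltr_wpDl; [rewrite divr_ge0// exprn_ge0// ltW|rewrite divr_gt0].
have uK u : s < u -> u < r -> u ^+ 2 * K <= A.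
  move=> su ur; have u0 : 0 < u by lra.
  apply: le_trans (lt_case _ _ s0 (ltW su) ur).
  have ur1 : u / r <= 1 by rewrite ler_pdivrMr// mul1r ltW.
  have := profile_scaling _ r (divr_gt0 u0 r0) ur1 (ltW r0) (lexx r).
  rewrite divfK ?gt_eqF// => h.
  rewrite /K mulrDr (mulrC _ (m / 2)) lerD2r.
  by move: h; rewrite expr_div_n mulrAC mulrA.
have -> : phi r + m / 2 * r ^+ 2 = r ^+ 2 * K by rewrite /K; field; rewrite gt_eqF.
rewrite -/A leNgt; apply/negP => Alt.
(* Small enough for s < r - e and (r - e)^2 K > A, the contradiction. *)
pose e := Num.min ((r ^+ 2 * K - A) / (2 * r * K)) (r - s) / 2.
have rK0 : 0 < 2 * r * K by rewrite !mulr_gt0.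
have me0 : 0 < Num.min ((r ^+ 2 * K - A) / (2 * r * K)) (r - s).
  by rewrite lt_min divr_gt0//; lra.
have me1 : Num.min ((r ^+ 2 * K - A) / (2 * r * K)) (r - s) <= r - s.
  by rewrite ge_min lexx orbT.
have me2 : Num.min ((r ^+ 2 * K - A) / (2 * r * K)) (r - s) * (2 * r * K) <= r ^+ 2 * K - A.
  by rewrite -ler_pdivlMr// ge_min lexx.
have e0 : 0 < e by rewrite /e; lra.
have ers : e < r - s by rewrite /e; lra.
have eK : e * (2 * r * K) < r ^+ 2 * K - A.
  by apply: lt_le_trans me2; rewrite ltr_pM2r// /e; lra.
have s_lt : s < r - e by lra.
have r_lt : r - e < r by lra.
have := uK _ s_lt r_lt.
have : 0 <= e ^+ 2 * K by rewrite mulr_ge0 ?sqr_ge0 ?ltW.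
have -> : (r - e) ^+ 2 * K = r ^+ 2 * K - e * (2 * r * K) + e ^+ 2 * K by ring.
lra.
Qed.

Lemma profile_decr (s t : R) : 0 <= s -> s <= t -> t <= r -> phi t <= phi s.
Proof.
move=> s0 st tr; have := profile_decr_quadratic _ _ s0 st tr.
have : m / 2 * s ^+ 2 <= m / 2 * t ^+ 2.
  by rewrite ler_wpM2l ?divr_ge0 ?(ltW m0)// ler_sqr ?nnegrE// (le_trans s0).
lra.
Qed.

(** Comparison with r gives phi s >= m (r^2 - s^2) / 2, and s <= r / 2 leaves the factor (1 - 1/4) /
    2 = 3/8. *)
Lemma profile_lower_bound (s : R) : 0 <= s -> s <= r / 2 -> 3 / 8 * m * r ^+ 2 <= phi s.
Proof.
move=> s0 sr; have r0 := profile_radius_gt0 hphi.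
have sr' : s <= r by lra.
have := profile_decr_quadratic _ _ s0 sr' (lexx r).
have phir : 0 <= phi r by apply: (profile_ge0 hphi); rewrite gtr0_norm.
have : m * s ^+ 2 <= m * (r / 2) ^+ 2.
  by rewrite ler_wpM2l ?(ltW m0)// ler_sqr ?nnegrE// (le_trans s0).
rewrite expr_div_n; lra.
Qed.

End decreasing_profile.

(** Near 0 the slope satisfies phi' >= - |M| x almost everywhere, so phi + |M| x^2 / 2 is
    nondecreasing there. *)
Lemma profile_flat_near0 : ess_bounded_slope_near0 phi ->
  exists e M : R, [/\ 0 < e, e <= r, 0 <= M &
    forall s t, 0 <= s -> s <= t -> t <= e -> phi s <= phi t + M * t ^+ 2].
Proof.
move=> [U [M [/nbhs_ballP[e0 /= e00 eU] aeU]]].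
have r0 := profile_radius_gt0 hphi.
have me : 0 < Num.min e0 r by rewrite lt_min e00.
have me0 : Num.min e0 r <= e0 by rewrite ge_min lexx.
have mer : Num.min e0 r <= r by rewrite ge_min lexx orbT.
exists (Num.min e0 r / 2), (`|M| / 2); split; [lra|lra|by rewrite divr_ge0|].
move=> s t s0 st te.
have H := locally_lipschitz_ae_quadratic_monotone _ phi s t 1 `|M| st _ _.
have : 1 * phi s + `|M| / 2 * s ^+ 2 <= 1 * phi t + `|M| / 2 * t ^+ 2.
  apply: H => [x|].
    rewrite in_itv/= => /andP[ux xv]; apply: (profile_lipschitz hphi).
    by rewrite ger0_norm; lra.
  apply: filterS aeU; first exact: (ae_filter_ringOfSetsType (@lebesgue_measure R)).
  move=> x + xst; move: xst; rewrite in_itv/= => /andP[sx xt].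
  have x0 : 0 < x by lra.
  move=> /(_ _)[|dx phix].
    by apply: eU; rewrite /ball/= sub0r normrN gtr0_norm//; lra.
  split => //; rewrite mul1r.
  have := le_trans phix (ler_norm M).
  rewrite ler_norml => /andP[+ _].
  by rewrite ler_pdivlMr// mulNr; lra.
have : 0 <= `|M| / 2 * s ^+ 2 by rewrite mulr_ge0 ?sqr_ge0 ?divr_ge0.
lra.
Qed.
End sufficiency.

(** * Finite partitions of segments and of directions *)

Lemma finite_cells (R : realType) (A e : R) : 0 < A -> 0 < e ->
  exists n (c : R -> 'I_n.+1), forall x y,
    `|x| <= A -> `|y| <= A -> c x = c y -> `|x - y| <= e.
Proof.
move=> A0 e0; pose k (x : R) := Num.truncn ((x + A) / e).
exists (Num.truncn (2 * A / e)), (fun x => inord (k x)) => x y xA yA.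
have bnd z : `|z| <= A -> 0 <= (z + A) / e /\ (k z <= Num.truncn (2 * A / e))%N.
  rewrite ler_norml => /andP[Az zA]; split; first by rewrite divr_ge0//; lra.
  by rewrite /k; apply: le_truncn; rewrite ler_pM2r ?invr_gt0//; lra.
have [x0 kx] := bnd _ xA; have [y0 ky] := bnd _ yA.
move=> /(congr1 val); rewrite /= !inordK ?ltnS// => kxy.
have /andP[] := truncn_itv x0; have /andP[] := truncn_itv y0.
rewrite -/(k x) -/(k y) kxy !ler_pdivlMr// !ltr_pdivrMr//.
move: (k y) => j; rewrite -natr1 mulrDl mul1r => h1 h2 h3 h4.
by rewrite ler_norml; apply/andP; split; lra.
Qed.

(** Lagrange's identity: |w|^2 |v|^2 - omega(w, v)^2 = <w, v>^2. *)
Lemma omega_le_enorm (R : realType) (v w : R * R) : `|omega w v| <= enorm w * enorm v.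
Proof.
have nn : 0 <= enorm w * enorm v by rewrite mulr_ge0// enorm_ge0.
rewrite -(@ler_pXn2r _ 2)// ?nnegrE//.
rewrite real_normK ?num_real// exprMn !enorm_sqr /omega -subr_ge0.
rewrite (_ : _ - _ = (w.1 * v.1 + w.2 * v.2) ^+ 2); last by ring.
exact: sqr_ge0.
Qed.

(** Here <w, v> = 1 - |w - v|^2 / 2 is at least 1 / 2, while omega(w, v) is linear in w - v and so
    at most 2 e <= 4 e <w, v> in absolute value. *)
Lemma unit_vectors_close (R : realType) (v w : R * R) (e : R) :
    v.1 ^+ 2 + v.2 ^+ 2 = 1 -> w.1 ^+ 2 + w.2 ^+ 2 = 1 ->
    `|w.1 - v.1| <= e -> `|w.2 - v.2| <= e -> e <= 1 / 2 ->
  `|omega w v| <= 4 * e * (w.1 * v.1 + w.2 * v.2) /\ 1 / 2 <= w.1 * v.1 + w.2 * v.2.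
Proof.
move: v w => [a b] [a' b'] /= v1 w1 da db e2.
have e0 : 0 <= e by apply: le_trans da.
have sq x : `|x| <= e -> x ^+ 2 <= e ^+ 2.
  by move=> xe; rewrite -(real_normK (num_real x)) ler_sqr ?nnegrE.
have := sq _ da; have := sq _ db => hb ha.
have e22 : e ^+ 2 <= 1 / 4 by nra.
have I2 : 1 / 2 <= a' * a + b' * b by nra.
split => //.
have w_1 : `|a'| <= 1.
  by rewrite -(@ler_pXn2r _ 2)// ?nnegrE// real_normK ?num_real// expr1n; nra.
have w_2 : `|b'| <= 1.
  by rewrite -(@ler_pXn2r _ 2)// ?nnegrE// real_normK ?num_real// expr1n; nra.
have -> : omega (a', b') (a, b) = b' * (a' - a) - a' * (b' - b) by rewrite /omega/=; ring.
apply: le_trans (ler_normB _ _) _; rewrite !normrM.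
have : `|b'| * `|a' - a| <= 1 * e by apply: ler_pM.
have : `|a'| * `|b' - b| <= 1 * e by apply: ler_pM.
nra.
Qed.

(** The colour is the cell of v / |v|, with cells so small that 4 e <= k. If v or w is 0, both
    inequalities read 0 <= 0. *)
Lemma finite_directions (R : realType) (k : R) : 0 < k ->
  exists (T : finType) (c : R * R -> T),
    (forall (t : R) v, 0 < t -> c (t * v.1, t * v.2) = c v) /\
    forall v w, c v = c w ->
      `|omega w v| <= k * (w.1 * v.1 + w.2 * v.2) /\
      enorm w * enorm v / 2 <= w.1 * v.1 + w.2 * v.2.
Proof.
move=> k0; pose e := Num.min (1 / 2) (k / 4).
have e0 : 0 < e by rewrite lt_min; apply/andP; split; lra.
have e2 : e <= 1 / 2 by rewrite ge_min lexx.
have ek : e <= k / 4 by rewrite ge_min lexx orbT.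
have [n [c cP]] := finite_cells _ 1 e ltr01 e0.
pose u (v : R * R) : R * R := (v.1 / enorm v, v.2 / enorm v).
exists ('I_n.+1 * 'I_n.+1)%type, (fun v => (c (u v).1, c (u v).2)); split.
  move=> t v t0; rewrite /u/= enormZ ?(ltW t0)//.
  have [v0|v0] := eqVneq (enorm v) 0; first by rewrite v0 mulr0 invr0 !mulr0.
  by congr (c _, c _); field; rewrite v0 gt_eqF.
have u1 v : enorm v != 0 -> (u v).1 ^+ 2 + (u v).2 ^+ 2 = 1.
  by move=> v0; rewrite /u/= !expr_div_n -mulrDl -enorm_sqr divff// expf_neq0.
have ub v : enorm v != 0 -> `|(u v).1| <= 1 /\ `|(u v).2| <= 1.
  move=> /u1 uv; split; rewrite -(@ler_pXn2r _ 2)// ?nnegrE// real_normK ?num_real// expr1n;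
    by rewrite -uv ?lerDl ?lerDr sqr_ge0.
have z0 v : enorm v = 0 -> v = (0, 0).
  move: v => [a b] v0; have := enorm_sqr _ (a, b); rewrite v0 expr0n/= => /esym/eqP.
  by rewrite paddr_eq0 ?sqr_ge0// !sqrf_eq0 => /andP[/eqP-> /eqP->].
move=> v w.
have [/z0->|v0] := eqVneq (enorm v) 0.
  by rewrite /omega /enorm/= !mulr0 expr0n/= !addr0 sqrtr0 !mulr0 mul0r subrr normr0.
have [/z0->|w0] := eqVneq (enorm w) 0.
  by rewrite /omega /enorm/= !mul0r expr0n/= !addr0 sqrtr0 !mul0r subrr normr0 mulr0.
have [v1 v2] := ub _ v0; have [w1 w2] := ub _ w0.
move=> [/esym/cP c1 /esym/cP c2].
have [h1 h2] := unit_vectors_close _ _ _ _ (u1 _ v0) (u1 _ w0) (c1 w1 v1) (c2 w2 v2) e2.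
have nv : 0 < enorm v by rewrite lt_neqAle eq_sym v0 enorm_ge0.
have nw : 0 < enorm w by rewrite lt_neqAle eq_sym w0 enorm_ge0.
have IE : w.1 * v.1 + w.2 * v.2 =
    enorm w * enorm v * ((u w).1 * (u v).1 + (u w).2 * (u v).2).
  by rewrite /u/=; field; rewrite v0 w0.
have oE : omega w v = enorm w * enorm v * omega (u w) (u v).
  by rewrite /u /omega/=; field; rewrite v0 w0.
rewrite IE oE normrM (gtr0_norm (mulr_gt0 nw nv)); split; last first.
  by rewrite ler_pM2l ?mulr_gt0//; lra.
rewrite mulrCA ler_pM2l ?mulr_gt0//; apply: (le_trans h1).
by apply: ler_wpM2r; lra.
Qed.

(* [s], [rho], [n] stand for |v|, |w|, |v - w|; [I] and [o] for <w, v> and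
   omega w v, the points being (v, z) and (w, zeta). *)
Lemma profile_contains_translate (R : realType) (phi : R -> R) (r m eta M e s0 B : R)
    (s rho n I o z zeta : R) :
    0 < r -> 0 < m -> eta <= r -> 0 <= M ->
    (forall x, 0 <= x -> x <= r -> 0 <= phi x) ->
    (forall x y, 0 <= x -> x <= y -> y <= r ->
      phi y + m / 2 * y ^+ 2 <= phi x + m / 2 * x ^+ 2) ->
    (forall x y, 0 <= x -> x <= y -> y <= eta -> phi x <= phi y + M * y ^+ 2) ->
    0 < e -> e * r <= s0 / 4 -> (2 + 25 * M) * (e * r) <= m * s0 / 8 ->
    5 * (e * r) <= eta -> e ^+ 2 * (phi 0 + 2 * r ^+ 2) <= B ->
    0 <= s -> s <= r -> 0 <= z -> z <= phi s -> 0 <= rho -> rho <= e * r ->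
    0 <= zeta -> zeta <= e ^+ 2 * phi 0 ->
    0 <= n -> n ^+ 2 = s ^+ 2 - 2 * I + rho ^+ 2 ->
    `|o| <= m / 2 * I -> `|o| <= rho * s -> rho * s / 2 <= I ->
    ((2 + 25 * M) * s ^+ 2 <= z) = ((2 + 25 * M) * rho ^+ 2 <= zeta) ->
    (z < (2 + 25 * M) * s ^+ 2 -> s0 <= s) ->
    ((2 + 25 * M) * s ^+ 2 <= z -> B <= z) ->
  n <= r /\ `|z - zeta - o / 2| <= phi n.
Proof.
move=> r0 m0 etar M0 phi0 decr flat e0 es0 eK eeta eB s_0 sr z0 zphi rho0 rhoe zeta0 zetae.
move=> n0 nE oI os sI same II_s I_z.
move: oI os; rewrite !ler_norml => /andP[oI1 oI2] /andP[os1 os2].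
have rs : 0 <= rho * s by rewrite mulr_ge0.
have I0 : 0 <= I by lra.
(* Since rho^2 <= rho s / 4 <= I / 2, the square of the norm drops by 2 I - rho^2 >= I, which raises
   phi by at least m I / 2. *)
have short : rho <= s / 4 -> n <= s /\ phi s + m / 2 * I <= phi n.
  move=> rho_s; have rho2 : rho ^+ 2 <= rho * (s / 4) by rewrite expr2 ler_wpM2l.
  have ns : n <= s by rewrite -(@ler_pXn2r _ 2)// ?nnegrE// nE; lra.
  split => //; have := decr _ _ n0 ns sr; rewrite nE => h.
  have : m / 2 * (s ^+ 2 - (s ^+ 2 - 2 * I + rho ^+ 2)) >= m / 2 * I.
    by rewrite ler_wpM2l ?divr_ge0 ?(ltW m0)//; lra.
  lra.
have phis : 0 <= phi s by apply: phi0.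
(* In the cone z < K s^2, with K = 2 + 25 M, zeta and |o| / 2 each cost at most m I / 4, together no
   more than the gain in phi. *)
have [Kz|zK] := leP ((2 + 25 * M) * s ^+ 2) z; last first.
  have s0s := II_s zK.
  have Kzeta : zeta < (2 + 25 * M) * rho ^+ 2.
    by rewrite ltNge -same -ltNge.
  have rho_s : rho <= s / 4 by lra.
  have [ns phin] := short rho_s.
  have : (2 + 25 * M) * rho ^+ 2 <= m / 4 * I.
    have h1 : (2 + 25 * M) * rho ^+ 2 <= (2 + 25 * M) * (e * r) * rho.
      rewrite expr2 -!mulrA ler_wpM2l ?addr_ge0 ?mulr_ge0//.
      by rewrite mulrA ler_wpM2r.
    have h2 := ler_wpM2r rho0 eK.
    have h3 : m * (rho * s0) <= m * (rho * s).
      by rewrite ler_wpM2l ?(ltW m0)// ler_wpM2l.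
    have h4 : m * (rho * s) <= m * (2 * I) by rewrite ler_wpM2l ?(ltW m0)//; lra.
    lra.
  move=> Krho; split; first lra.
  by apply/andP; split; lra.
have Kzeta : (2 + 25 * M) * rho ^+ 2 <= zeta by rewrite -same.
have Bz := I_z Kz.
have r2 : 0 <= e ^+ 2 * (2 * r ^+ 2).
  by rewrite pmulr_rge0 ?exprn_gt0// pmulr_rge0// sqr_ge0.
have zz : zeta <= z by lra.
(* If s <= 4 rho, then n <= 5 rho: phi varies by at most 25 M rho^2 and |o| / 2 <= 2 rho^2, so zeta
   >= (2 + 25 M) rho^2 absorbs both. The lower bound follows from z >= B >= zeta + 2 rho^2. *)
have [rho_s|/ltW s_rho] := leP rho (s / 4).
  have [ns phin] := short rho_s.
  split; first lra.
  by apply/andP; split; lra.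
have rho2 : rho ^+ 2 <= e ^+ 2 * r ^+ 2.
  by rewrite -exprMn ler_sqr ?nnegrE// mulr_ge0 ?ltW.
have rs4 : rho * s <= 4 * rho ^+ 2.
  by rewrite expr2 mulrCA ler_wpM2l//; lra.
have n5 : n <= 5 * rho.
  have ss : s ^+ 2 <= s * (4 * rho) by rewrite expr2 ler_wpM2l//; lra.
  have r5 : 0 <= 5 * rho by rewrite mulr_ge0.
  rewrite -(@ler_pXn2r _ 2)// ?nnegrE// nE exprMn; lra.
have neta : n <= eta by lra.
have phin : 0 <= phi n by apply: phi0; lra.
have : phi s <= phi n + 25 * M * rho ^+ 2.
  have [sn|/ltW ns] := leP s n.
    have h : M * n ^+ 2 <= M * (5 * rho) ^+ 2.
      by rewrite ler_wpM2l// ler_sqr ?nnegrE// mulr_ge0.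
    have := flat _ _ s_0 sn neta; rewrite exprMn in h; lra.
  have h : m / 2 * n ^+ 2 <= m / 2 * s ^+ 2.
    by rewrite ler_wpM2l ?divr_ge0 ?(ltW m0)// ler_sqr ?nnegrE.
  have hM : 0 <= 25 * M * rho ^+ 2 by rewrite mulr_ge0 ?sqr_ge0// pmulr_rge0.
  have := decr _ _ n0 ns sr; lra.
move=> phisn; split; first lra.
by apply/andP; split; lra.
Qed.

(** The sign of z, the comparison of |z| with K |v|^2 and the direction of v are invariant under
    dilations. This reduces the claim to d(0, p) = 1, where [profile_contains_translate] applies. *)
Lemma finite_cones_absorb (R : realType) (d : heis R -> heis R -> R) (r : R)
    (phi : R -> R) (hd : homogeneous_distance d) (hphi : radial_profile d r phi)
    (m : R) (m0 : 0 < m)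
    (aephi : ae_derive1 phi `]0, r[ (fun s y => y <= - m * s)) :
  ess_bounded_slope_near0 phi ->
  exists (T : finType) (col : heis R -> T) (e : R), [/\ 0 < e, e < 1 &
    forall p q, col p = col q -> 0 < d (horigin R) p ->
      d (horigin R) q <= e * d (horigin R) p -> d q p <= d (horigin R) p].
Proof.
move=> slope0.
have [eta [M [eta0 etar M0 flat]]] := profile_flat_near0 _ _ _ _ hphi slope0.
have r0 := profile_radius_gt0 hphi.
have decr := profile_decr_quadratic _ _ _ _ hd hphi _ m0 aephi.
have dec := profile_decr _ _ _ _ hd hphi _ m0 aephi.
have low := profile_lower_bound _ _ _ _ hd hphi _ m0 aephi.
have phi_ge0 x : 0 <= x -> x <= r -> 0 <= phi x.
  by move=> x0 xr; apply: (profile_ge0 hphi); rewrite ger0_norm.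
set c := 3 / 8 * m * r ^+ 2 in low.
have c0 : 0 < c by rewrite /c !mulr_gt0.
pose K := 2 + 25 * M.
have K0 : 0 < K by rewrite /K; lra.
(* Capped at 1 so that s1^2 <= s1 <= c / (4 K), which avoids a square root. *)
pose s1 := Num.min 1 (c / (4 * K)).
have s1_gt0 : 0 < s1 by rewrite lt_min ltr01 divr_gt0// mulr_gt0.
have s1_le1 : s1 <= 1 by rewrite ge_min lexx.
have s1_lec : s1 * (4 * K) <= c by rewrite -ler_pdivlMr ?mulr_gt0// ge_min lexx orbT.
pose s0 := Num.min (r / 4) s1.
have s0_gt0 : 0 < s0 by rewrite lt_min s1_gt0 andbT; lra.
have s0_ler : s0 <= r / 4 by rewrite ge_min lexx.
have s0_le1 : s0 <= s1 by rewrite ge_min lexx orbT.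
pose B := Num.min (K * r ^+ 2 / 16) (c / 4).
have B_gt0 : 0 < B by rewrite lt_min !divr_gt0 ?mulr_gt0 ?exprn_gt0.
have B_ler : B <= K * r ^+ 2 / 16 by rewrite ge_min lexx.
have B_lec : B <= c / 4 by rewrite ge_min lexx orbT.
have phi00 : 0 <= phi 0 by apply: phi_ge0 => //; exact: ltW.
have P0 : 0 < phi 0 + 2 * r ^+ 2 by rewrite ltr_wpDl// mulr_gt0// exprn_gt0.
have [e [e0 e1 er1 er2 [er3 er4]]] : exists e, [/\ 0 < e, e < 1, e * r <= s0 / 4,
    K * (e * r) <= m * s0 / 8 &
    5 * (e * r) <= eta /\ e ^+ 2 * (phi 0 + 2 * r ^+ 2) <= B].
  near (0 : R)^'+ => e.
  have e0 : 0 < e by [].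
  have e1 : e < 1 by near: e; exact: nbhs_right_lt.
  have eP : e * (phi 0 + 2 * r ^+ 2) <= B.
    by rewrite -ler_pdivlMr//; near: e; apply: nbhs_right_le; rewrite divr_gt0.
  have er : e * r <= s0 / 4.
    by rewrite -ler_pdivlMr//; near: e; apply: nbhs_right_le; rewrite !divr_gt0.
  have eKr : e * (K * r) <= m * s0 / 8.
    rewrite -ler_pdivlMr ?mulr_gt0//; near: e; apply: nbhs_right_le.
    by rewrite !divr_gt0 ?mulr_gt0.
  have er5 : e * (5 * r) <= eta.
    rewrite -ler_pdivlMr ?mulr_gt0//; near: e; apply: nbhs_right_le.
    by rewrite !divr_gt0 ?mulr_gt0.
  exists e; split => //; [by rewrite mulrCA|split; first by rewrite mulrCA].
  apply: le_trans eP; rewrite expr2 -mulrA ler_piMl ?ltW//.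
  exact: mulr_gt0.
have [T [c_ [cZ cP]]] := finite_directions _ (m / 2) (divr_gt0 m0 (ltr0n _ 2)).
pose col (p : heis R) := ((0 <= p.2, K * enorm p.1 ^+ 2 <= `|p.2|), c_ p.1).
have colZ t p : 0 < t -> col (hdil t p) = col p.
  move=> t0; rewrite /col/= cZ// enormZ ?(ltW t0)// pmulr_rge0 ?exprn_gt0//.
  rewrite normrM (gtr0_norm (exprn_gt0 2 t0)) exprMn mulrCA.
  by rewrite ler_pM2l// exprn_gt0.
exists (bool * bool * T)%type, col, e; split => // p q.
have key P Q : d (horigin R) P = 1 -> d (horigin R) Q <= e -> col P = col Q -> d Q P <= 1.
  move=> dP dQ [zz KK cc].
  have [sr zphi] : enorm P.1 <= r /\ - phi (enorm P.1) <= P.2 <= phi (enorm P.1).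
    by apply/(dist0_le1 _ _ _ _ hphi); rewrite dP.
  move: zphi; rewrite -ler_norml => zphi.
  have [rhoe zeta] := (dist0_le _ _ hd _ _ hphi _ _ e0).1 dQ.
  have s_0 := enorm_ge0 _ P.1; have rho0 := enorm_ge0 _ Q.1.
  have {}zeta : `|Q.2| <= e ^+ 2 * phi 0.
    apply: (le_trans zeta); rewrite ler_pM2l ?exprn_gt0//; apply: dec => //.
      by rewrite divr_ge0// ltW.
    by rewrite ler_pdivrMr// mulrC.
  (* Otherwise P would lie in the ball of radius 1 / 2, because phi >= c on [0, r / 2]. The
     alternative yields the lower bound s0 on |v| in one kind of cone and B on |z| in the other. *)
  have alt : r / 4 < enorm P.1 \/ c / 4 < `|P.2|.
    have [h1|h1] := ltP (r / 4) (enorm P.1); first by left.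
    have [h2|h2] := ltP (c / 4) `|P.2|; first by right.
    have h : d (horigin R) P <= 2^-1.
      apply/(dist0_le _ _ hd _ _ hphi); rewrite ?invr_gt0//; split; first lra.
      have := low (enorm P.1 / 2^-1); rewrite invrK => h.
      have : c <= phi (enorm P.1 * 2) by apply: h; lra.
      by lra.
    by rewrite dP in h; lra.
  have [oI sI] := cP _ _ cc.
  have os := omega_le_enorm _ P.1 Q.1.
  rewrite (dist_hsubl _ _ hd); apply/(dist0_le1 _ _ _ _ hphi); rewrite -ler_norml.
  have nE : enorm (hsubl Q P).1 ^+ 2 =
      enorm P.1 ^+ 2 - 2 * (Q.1.1 * P.1.1 + Q.1.2 * P.1.2) + enorm Q.1 ^+ 2.
    by rewrite !enorm_sqr/=; ring.
  (* Only |o| matters, so points with z < 0 are treated by reversing the signs of both heights and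
     of omega. *)
  have main o : `|o| = `|omega Q.1 P.1| ->
      enorm (hsubl Q P).1 <= r /\ `| `|P.2| - `|Q.2| - o / 2| <= phi (enorm (hsubl Q P).1).
    move=> oE.
    apply: (profile_contains_translate _ phi r m eta M e s0 B (enorm P.1) (enorm Q.1)
      _ (Q.1.1 * P.1.1 + Q.1.2 * P.1.2)) => //; rewrite ?oE//; try exact: enorm_ge0.
    - move=> zK; have [?|cz] := alt; first lra.
      apply: (le_trans s0_le1); rewrite -(@ler_pXn2r _ 2)// ?nnegrE ?(ltW s1_gt0)//.
      have : s1 ^+ 2 <= s1 by rewrite expr2 ler_piMl// ltW.
      move=> s11; apply: (le_trans s11).
      rewrite -(@ler_pM2r _ (4 * K)) ?mulr_gt0//; rewrite -/K in zK; lra.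
    - move=> Kz; have [rs|cz] := alt; last lra.
      apply: le_trans Kz; apply: (le_trans B_ler); rewrite -/K.
      rewrite -mulrA ler_pM2l//.
      have : (r / 4) ^+ 2 <= enorm P.1 ^+ 2.
        by rewrite ler_sqr ?nnegrE// ?(ltW rs)// divr_ge0// ltW.
      by rewrite expr_div_n; lra.
  have [P2|P2] := leP 0 P.2.
    have Q2 : 0 <= Q.2 by rewrite -zz.
    by have := main _ erefl; rewrite (ger0_norm P2) (ger0_norm Q2).
  have Q2 : Q.2 < 0 by rewrite ltNge -zz -ltNge.
  have := main (- omega Q.1 P.1) (normrN _).
  rewrite (ltr0_norm P2) (ltr0_norm Q2) => -[? h]; split => //.
  rewrite -normrN; move: h; congr (`| _ | <= _); rewrite /=; ring.
move=> cpq p0 dq; pose t := (d (horigin R) p)^-1.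
have t0 : 0 < t by rewrite invr_gt0.
have := key (hdil t p) (hdil t q).
rewrite !colZ// !(dist_hdil0 _ _ hd)// (hom_dilation hd)// mulVf ?gt_eqF//.
rewrite !ler_pdivrMl// mulr1 mulrC; by apply.
Unshelve. all: by end_near. Qed.

(** Balls are bounded in coordinates, and if the coordinates of p and q differ by at most [dl], then
    p^-1 q has horizontal norm at most 2 [dl] <= e r / 2 and height at most (1 + A) [dl] <= e^2 c0,
    where c0 bounds phi from below on [0, r / 2]. *)
Lemma finite_small_cells (R : realType) (d : heis R -> heis R -> R) (r : R)
    (phi : R -> R) (hd : homogeneous_distance d) (hphi : radial_profile d r phi)
    (m : R) (m0 : 0 < m)
    (aephi : ae_derive1 phi `]0, r[ (fun s y => y <= - m * s)) (L e : R) :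
  0 < L -> 0 < e -> exists (T : finType) (c : heis R -> T), forall p q,
    d (horigin R) p <= L -> d (horigin R) q <= L -> c p = c q -> d p q <= e.
Proof.
move=> L0 e0; have r0 := profile_radius_gt0 hphi.
have phi00 : 0 <= phi 0 by apply: (profile_ge0 hphi); rewrite normr0 ltW.
pose c0 := 3 / 8 * m * r ^+ 2.
have c0_gt0 : 0 < c0 by rewrite /c0 !mulr_gt0.
pose A := L * r + L ^+ 2 * phi 0.
have LP : 0 <= L ^+ 2 * phi 0 by rewrite mulr_ge0 ?sqr_ge0.
have Lr : 0 < L * r by rewrite mulr_gt0.
have A0 : 0 < A by rewrite /A; lra.
pose dl := Num.min (e * r / 4) (e ^+ 2 * c0 / (1 + A)).
have dl0 : 0 < dl by rewrite lt_min !divr_gt0 ?mulr_gt0 ?exprn_gt0// addr_gt0.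
have dl1 : dl <= e * r / 4 by rewrite ge_min lexx.
have dl2 : dl * (1 + A) <= e ^+ 2 * c0.
  have A1 : 0 < 1 + A by rewrite addr_gt0.
  by rewrite -(ler_pdivlMr _ _ A1) ge_min lexx orbT.
have [n [c cP]] := finite_cells _ A dl A0 dl0.
exists ('I_n.+1 * 'I_n.+1 * 'I_n.+1)%type, (fun p => (c p.1.1, c p.1.2, c p.2)).
have box p : d (horigin R) p <= L -> [/\ `|p.1.1| <= A, `|p.1.2| <= A & `|p.2| <= A].
  move=> /(dist0_le _ _ hd _ _ hphi _ _ L0)[pr pphi].
  have h1 : `|p.1.1| <= enorm p.1.
    rewrite -(@ler_pXn2r _ 2)// ?nnegrE ?enorm_ge0// real_normK ?num_real//.
    by rewrite enorm_sqr lerDl sqr_ge0.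
  have h2 : `|p.1.2| <= enorm p.1.
    rewrite -(@ler_pXn2r _ 2)// ?nnegrE ?enorm_ge0// real_normK ?num_real//.
    by rewrite enorm_sqr lerDr sqr_ge0.
  have h3 : phi (enorm p.1 / L) <= phi 0.
    apply: (profile_decr _ _ _ _ hd hphi _ m0 aephi) => //.
      by rewrite divr_ge0 ?enorm_ge0// ltW.
    by rewrite ler_pdivrMr// mulrC.
  have h4 : L ^+ 2 * phi (enorm p.1 / L) <= L ^+ 2 * phi 0 by rewrite ler_wpM2l ?sqr_ge0.
  by split; rewrite /A; lra.
move=> p q /box[p1 p2 p3] /box[q1 q2 q3] [c1 c2 c3].
have e1 := cP _ _ q1 p1 (esym c1); have e2 := cP _ _ q2 p2 (esym c2).
have e3 := cP _ _ q3 p3 (esym c3).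
rewrite (dist_hsubl _ _ hd); apply/(dist0_le _ _ hd _ _ hphi) => //.
have en : enorm (hsubl p q).1 <= e * r / 2.
  apply: (@le_trans _ _ (2 * dl)); last lra.
  have ? : 0 <= 2 * dl by rewrite mulr_ge0 ?ltW.
  rewrite -(@ler_pXn2r _ 2)// ?nnegrE ?enorm_ge0// enorm_sqr/=.
  have sq x : `|x| <= dl -> x ^+ 2 <= dl ^+ 2.
    by move=> xe; rewrite -(real_normK (num_real x)) ler_sqr ?nnegrE// ltW.
  have := sq _ e1; have := sq _ e2; have := sqr_ge0 dl; rewrite exprMn; lra.
have er0 : 0 < e * r by rewrite mulr_gt0.
split; first by lra.
have low : c0 <= phi (enorm (hsubl p q).1 / e).
  apply: (profile_lower_bound _ _ _ _ hd hphi _ m0 aephi).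
    by rewrite divr_ge0 ?enorm_ge0// ltW.
  by rewrite ler_pdivrMr//; lra.
apply: (@le_trans _ _ (e ^+ 2 * c0)); last by rewrite ler_wpM2l ?sqr_ge0.
apply: le_trans dl2; rewrite /hsubl/=.
have -> : omega p.1 q.1 = p.1.1 * (q.1.2 - p.1.2) - p.1.2 * (q.1.1 - p.1.1).
  by rewrite /omega; ring.
apply: (le_trans (ler_normB _ _)); rewrite normrM [`|2^-1|]ger0_norm ?invr_ge0//.
have h5 : `|p.1.1 * (q.1.2 - p.1.2) - p.1.2 * (q.1.1 - p.1.1)| <= A * dl + A * dl.
  by apply: (le_trans (ler_normB _ _)); rewrite !normrM; apply: lerD; apply: ler_pM.
lra.
Qed.

(** Balls of the family inject into a finite type: the cone of the centre, and its cell after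
    rescaling by the size of a reference centre in the same cone. *)
Lemma slope_BCP (R : realType) (d : heis R -> heis R -> R) (r : R)
    (phi : R -> R) (hd : homogeneous_distance d) (hphi : radial_profile d r phi)
    (m : R) (m0 : 0 < m)
    (aephi : ae_derive1 phi `]0, r[ (fun s y => y <= - m * s)) :
  ess_bounded_slope_near0 phi -> BCP d.
Proof.
move=> slope0.
have hdist := hom_distance hd.
have [T [col [e [e0 e1 colP]]]] := finite_cones_absorb _ _ _ _ hd hphi _ m0 aephi slope0.
have ei0 : 0 < e^-1 by rewrite invr_gt0.
have [T' [c cP]] := finite_small_cells _ _ _ _ hd hphi _ m0 aephi _ _ ei0 e0.
pose U : finType := (bool * T * T')%type.
exists #|U|.+1 => // F [Fpos Fsep [x Fx]].
pose tr (b : heis R * R) := hsubl x b.1.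
have trd b b' : d (tr b) (tr b') = d b.1 b'.1.
  have trE p : hsubl x p = hmul ((- x.1.1, - x.1.2), - x.2) p.
    by rewrite /hsubl /hmul /omega/=; congr (_, _, _); field.
  by rewrite /tr !trE (hom_left_invariant hd).
pose N b := d (horigin R) (tr b).
have N_le b : F b -> N b <= b.2.
  move=> /Fx; rewrite /cball/= /N /tr -(dist_hsubl _ _ hd).
  by rewrite (dist_sym hdist).
have N_ge0 b : 0 <= N b by exact: dist_ge0 hdist _ _.
(* The common point lies in b, so N b is at most its radius and the Besicovitch condition
   applies. *)
have sep b b' : F b -> F b' -> d (tr b) (tr b') <= N b -> b = b'.
  move=> Fb Fb' dbb; apply: contrapT => bb'.
  apply: (Fsep b' b) => //; rewrite /cball/= -trd.
  exact: le_trans dbb (N_le _ Fb).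
pose good t b := [/\ F b, 0 < N b & col (tr b) = t].
(* The default value is returned only for colours that no ball with N b > 0 carries. *)
pose ref t : heis R * R := xget (horigin R, 0) (good t).
pose code b : U := (0 < N b, col (tr b), c (hdil (N (ref (col (tr b))))^-1 (tr b))).
have code_inj : {in F &, injective code}.
  move=> b b'; rewrite !inE => Fb Fb'; rewrite /code => -[Nbb' colbb' cbb'].
  (* Balls with N b = 0 are centred at the common point, so there is at most one. *)
  have [Nb0|Nb0] := leP (N b) 0.
    have Nb'0 : N b' <= 0 by rewrite leNgt -Nbb' -leNgt.
    have z0 a : N a <= 0 -> tr a = horigin R.
      move=> Na; apply/esym/(dist_eq0 hdist); apply/eqP.
      by rewrite eq_le Na N_ge0.
    apply: sep => //; rewrite (z0 b)// (z0 b')//.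
    by rewrite (_ : d _ _ = 0) ?N_ge0//; apply/(dist_eq0 hdist).
  have Nb'0 : 0 < N b' by rewrite -Nbb'.
  set t := col (tr b) in cbb'; rewrite -colbb' -/t in cbb'.
  have [Fb0 Nb00 colb0] : good t (ref t).
    by apply: (xgetPex (horigin R, 0)); exists b.
  set b0 := ref t in Fb0 Nb00 colb0 cbb'.
  (* If one size were below e times the other, absorption and separation would make the two balls
     equal, which is absurd as e < 1. *)
  have ratio a : F a -> 0 < N a -> col (tr a) = t ->
      e * N b0 <= N a /\ N a <= e^-1 * N b0.
    move=> Fa Na cola; split; rewrite leNgt; apply/negP => lt_.
      have /(sep _ _ Fb0 Fa) ab : d (tr b0) (tr a) <= N b0.
        rewrite (dist_sym hdist); apply: colP => //; first by rewrite colb0.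
        exact: ltW.
      by move: lt_; rewrite -ab ltNge ger_pMl ?(ltW e1).
    have lt_' : N b0 < e * N a by rewrite -ltr_pdivrMl.
    have /(sep _ _ Fa Fb0) ab : d (tr a) (tr b0) <= N a.
      rewrite (dist_sym hdist); apply: colP => //; first by rewrite colb0.
      exact: ltW.
    by move: lt_'; rewrite -ab ltNge ger_pMl ?(ltW e1).
  have [rb rb'] := ratio b Fb Nb0 erefl.
  have [rb1 rb1'] := ratio b' Fb' Nb'0 (esym colbb').
  have iN : 0 < (N b0)^-1 by rewrite invr_gt0.
  have scaled a : N a <= e^-1 * N b0 -> d (horigin R) (hdil (N b0)^-1 (tr a)) <= e^-1.
    by move=> Na; rewrite (dist_hdil0 _ _ hd)// ler_pdivrMl// mulrC.
  (* Rescaled points of one cell are e-close, so the centres are within e N b0 <= N b and [sep]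
     identifies the balls. *)
  have := cP _ _ (scaled _ rb') (scaled _ rb1') cbb'.
  rewrite (hom_dilation hd)// ler_pdivrMl// mulrC => dbb'.
  by apply: sep => //; exact: le_trans dbb' rb.
pose code_nat b : nat := enum_rank (code b).
have code_nat_inj : {in F &, injective code_nat}.
  by move=> b b' Fb Fb' /val_inj/enum_rank_inj; exact: code_inj.
rewrite -(card_le_eql (inj_card_eq code_nat_inj)); apply: subset_card_le.
by move=> _ [b _ <-]/=; rewrite ltnW// ltnS ltn_ord.
Qed.

Theorem theorem1p6 (R : realType) (d : heis R -> heis R -> R)
    (r : R) (phi : R -> R)
    (hd : homogeneous_distance d)
    (hrotinv : rotationally_invariant d)
    (hphi : radial_profile d r phi) :
  (C1_on phi `](- r), r[ -> derivable (derive1 phi) 0 1 ->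
     ess_bounded_slope_near0 phi) /\
  (ess_bounded_slope_near0 phi ->
     (BCP d <->
      exists2 m : R, 0 < m &
        ae_derive1 phi `]0, r[ (fun s y => y <= - m * s))).
Proof.
split; first exact: (C1_ess_bounded_slope _ _ _ _ hphi).
move=> slope0; split=> [bcp|[m m0 aephi]]; last first.
  exact: (slope_BCP _ _ _ _ hd hphi _ m0 aephi slope0).
have [m m0 slope] := BCP_slope_bound _ _ _ _ hd hphi bcp.
exists m => //.
(* The slope bound holds at every point of differentiability, and these points have full measure. *)
have aed : {ae @lebesgue_measure R, forall x, x \in `]0, r[ -> derivable phi x 1}.
  apply: locally_lipschitz_ae_derivable => s; rewrite in_itv/= => /andP[s0 sr].
  by apply: (profile_lipschitz hphi); rewrite gtr0_norm.
have fmu := ae_filter_ringOfSetsType (@lebesgue_measure R).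
by apply: filterS aed => s ds /= s0r; split; [exact: ds|exact: slope (ds s0r)].
Qed.
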